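(* Let $p$ be a prime, let $k\geq 1$ be an integer, let $f\in F_p[x]$ be an irreducible polynomial of degree $k$, let $K_f=F_p[x]/(f)$ be the corresponding finite field, and let $X_f$ be its graph. The additive subgraph of $X_f$ is connected if and only if $x$ is normal. The multiplicative subgraph of $X_f$ is connected if and only if $x$ is primitive.
   Context: $F_p$ is the field with $p$ elements, and the class of the polynomial $x$ in $K_f=F_p[x]/(f)$ is again denoted $x$. Let $S=\{x,x^p,x^{p^2},\dots,x^{p^{k-1}}\}\subset K_f$ be the set of conjugates of $x$. The undirected multigraph $X_f$ has vertex set $K_f$ and the following edges. For all $y,z\in K_f$ and $s\in S$ with $z-y=s$ there is an additive edge between $y$ and $z$. For all $y,z\in K_f\setminus\{0\}$ and $s\in S$ with $zy^{-1}=s$ there is a multiplicative edge between $y$ and $z$. The additive subgraph has vertex set $K_f$ and all additive edges. The multiplicative subgraph has vertex set $K_f^\times=K_f\setminus\{0\}$ (the vertex $0$ is removed) and all multiplicative edges. The element $x$ is primitive if it generates the group of units $K_f^\times$, and it is normal if its conjugates (i.e. the set $S$) form a basis of $K_f$ as a vector space over $F_p$.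
   Formalization: In the degenerate case p = 2, f = x, where x is 0 in K_f and the unit group is trivial, x is counted as primitive; if a primitive x must be a unit, the multiplicative equivalence fails there, since the one-vertex subgraph is connected. *)

(* Defs.v *)
From HB Require Import structures.
From mathcomp Require Import all_boot all_order all_algebra all_fingroup.
From mathcomp Require Import all_field.

Set Implicit Arguments.
Unset Strict Implicit.
Unset Printing Implicit Defensive.

Import GRing.Theory.
Local Open Scope ring_scope.

(* Edges carry arbitrary labels, so parallel edges and loops are allowed.  The
   order of the two ends of an edge is ignored by [adjacent]. *)
Record multigraph := Multigraph {
  vertex : finType;
  edge : finType;
  ends : edge -> vertex * vertex
}.

Record subgraph (G : multigraph) := Subgraph {
  sub_vertices : {set vertex G};
  sub_edges : {set edge G};
  sub_ends : {in sub_edges, forall e,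
    ((ends e).1 \in sub_vertices) && ((ends e).2 \in sub_vertices)}
}.

Definition adjacent (G : multigraph) (H : subgraph G) : rel (vertex G) :=
  fun y z =>
    [exists e in sub_edges H, (ends e == (y, z)) || (ends e == (z, y))].

Definition connected (G : multigraph) (H : subgraph G) : Prop :=
  {in sub_vertices H &, forall y z, connect (adjacent H) y z}.

Section QuotientField.

Variables (F : finFieldType) (f : {poly F}).

Definition monic_associate : {poly F} := (lead_coef f)^-1 *: f.

Lemma monic_associate_irreducible :
  irreducible_poly f -> monic_irreducible_poly monic_associate.
Proof.
move=> irr_f; have nz_f := irredp_neq0 irr_f.
have nz_c : (lead_coef f)^-1 != 0 by rewrite invr_eq0 lead_coef_eq0.
split; last by rewrite monicE lead_coefZ mulVf ?lead_coef_eq0.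
split=> [|q size_q]; first by rewrite size_scale //; case: irr_f.
rewrite dvdpZr // => /(irr_f.2 q size_q) /eqp_trans; apply.
by rewrite eqp_sym eqp_scale.
Qed.

End QuotientField.

(* The quotient construction {poly %/ h} needs h monic; f and its monic
   associate generate the same ideal. *)
Notation quotient_field irr_f :=
  {poly %/ monic_associate _ with monic_associate_irreducible irr_f}.

Definition quotient_X (F : finFieldType) (f : {poly F})
    (irr_f : irreducible_poly f) : quotient_field irr_f :=
  in_qpoly (monic_associate f) 'X.

Section ConjugateGraph.

Variables (p : nat) (f : {poly 'F_p}) (irr_f : irreducible_poly f).

Local Notation K := (quotient_field irr_f).
Local Notation x := (quotient_X irr_f).

Definition conjugates_of_X : {set K} := [set x ^+ (p ^ i) | i : 'I_(size f).-1].

Definition is_additive_edge : pred (K * K * K) :=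
  fun '(y, z, s) => (s \in conjugates_of_X) && (z - y == s).

Definition is_multiplicative_edge : pred (K * K * K) :=
  fun '(y, z, s) => [&& y != 0, z != 0, s \in conjugates_of_X & z / y == s].

Definition conjugate_graph : multigraph :=
  {| vertex := K;
     edge := ({e | is_additive_edge e} + {e | is_multiplicative_edge e})%type;
     ends e := match e with inl a => (val a).1 | inr m => (val m).1 end |}.

Definition additive_edges : {set edge conjugate_graph} :=
  [set e | if e is inl _ then true else false].

Definition multiplicative_edges : {set edge conjugate_graph} :=
  [set e | if e is inr _ then true else false].

Definition nonzero_vertices : {set vertex conjugate_graph} :=
  [set y : K | y != 0].

Lemma additive_ends : {in additive_edges, forall e,
  ((ends e).1 \in [set: vertex conjugate_graph]) &&
  ((ends e).2 \in [set: vertex conjugate_graph])}.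
Proof. by move=> e _; rewrite !in_setT. Qed.

Lemma multiplicative_ends : {in multiplicative_edges, forall e,
  ((ends e).1 \in nonzero_vertices) && ((ends e).2 \in nonzero_vertices)}.
Proof.
move=> [a|[[[y z] s] /= yzs]]; rewrite !inE //= => _.
by case/and4P: yzs => -> ->.
Qed.

Definition additive_subgraph : subgraph conjugate_graph :=
  Subgraph additive_ends.

Definition multiplicative_subgraph : subgraph conjugate_graph :=
  Subgraph multiplicative_ends.

Definition normal_X : bool :=
  basis_of (fullv : {vspace K}) (enum conjugates_of_X).

(* The set on the left is the singleton {x} unless x = 0, that is, unless f is
   associate to 'X.  In that case it is empty and generates the trivial group,
   so x counts as primitive only when p = 2, where K^* is itself trivial. *)
Definition primitive_X : Prop :=
  (<<[set u : {unit K} | val u == x]>> = [set: {unit K}])%g.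

End ConjugateGraph.

(* Main.v *)
(* Each graph is a Cayley graph: the component of the identity is the subgroup
   generated by S.  In the additive group of K_f this subgroup is the F_p-span
   of S, since F_p is a prime field, and S spans exactly when it is a basis,
   because it has at most k = dim K_f elements.  In K_f^* every element of S is a
   power of x and x is in S, so the subgroup is the one generated by x. *)

Require Import Defs.
From mathcomp Require Import all_boot all_order all_algebra all_fingroup.
From mathcomp Require Import all_field.

Set Implicit Arguments.
Unset Strict Implicit.
Unset Printing Implicit Defensive.

Import GRing.Theory.
Local Open Scope ring_scope.

(** Symmetry makes one-way preservation along edges two-way, as [closed] demands. With [P]
    membership in the span of the conjugates, or in the subgroup generated by x, this traps the
    component of the identity. *)
Lemma connect_sym_invariant (T : finType) (e : rel T) (P : pred T) (y z : T) :
  symmetric e -> (forall a b, e a b -> P a -> P b) ->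
  connect e y z -> P y -> P z.
Proof.
move=> e_sym eP yz; suff /closed_connect/(_ _ _ yz) : closed e P.
  by rewrite /in_mem /= => ->.
by move=> a b ab; apply/idP/idP; apply: eP; rewrite // e_sym.
Qed.

Lemma adjacent_sym (G : multigraph) (H : subgraph G) : symmetric (adjacent H).
Proof. by move=> y z; rewrite /adjacent; under eq_existsb do rewrite orbC. Qed.

(** The quotient is carried by the polynomials of size below that of [mk_monic h], which is [h]
    itself because [h] is monic. *)
Lemma dim_qfpoly (F : fieldType) (h : {poly F})
    (hI : monic_irreducible_poly h) :
  \dim (fullv : {vspace {poly %/ h with hI}}) = (size h).-1.
Proof. by rewrite -[in RHS](mk_monicE hI); apply: dim_polyn. Qed.

Section ConjugateGraph.

Variables (p : nat) (f : {poly 'F_p}) (irr_f : irreducible_poly f).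

Local Notation K := (quotient_field irr_f).
Local Notation x := (quotient_X irr_f).
Local Notation S := (conjugates_of_X irr_f).

Lemma additive_adjacentE (y z : K) :
  adjacent (additive_subgraph irr_f) y z = (z - y \in S) || (y - z \in S).
Proof.
apply/existsP/orP => [[[[[[a b] s] /= abs]|m]] /andP[]|]; rewrite ?inE //=.
  by case/andP: abs => sS /eqP def_s _ /orP[] /eqP[<- <-]; [left|right];
     rewrite def_s.
case=> sS.
  have yz : is_additive_edge (y, z, z - y) by rewrite /= sS eqxx.
  by exists (inl (exist (fun e => is_additive_edge e) _ yz)); rewrite !inE /= eqxx.
have zy : is_additive_edge (z, y, y - z) by rewrite /= sS eqxx.
by exists (inl (exist (fun e => is_additive_edge e) _ zy)); rewrite !inE /= eqxx orbT.
Qed.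

Lemma multiplicative_adjacentE (y z : K) :
  adjacent (multiplicative_subgraph irr_f) y z =
  [&& y != 0, z != 0 & (z / y \in S) || (y / z \in S)].
Proof.
apply/existsP/and3P => [[[m|[[[a b] s] /= abs]]] /andP[]|]; rewrite ?inE //=.
  case/and4P: abs => a0 b0 sS /eqP def_s _ /orP[] /eqP[<- <-]; split=> //;
    by rewrite def_s sS ?orbT.
case=> y0 z0 /orP[] sS.
  have yz : is_multiplicative_edge (y, z, z / y).
    by rewrite /= y0 z0 sS eqxx.
  by exists (inr (exist (fun e => is_multiplicative_edge e) _ yz)); rewrite !inE /= eqxx.
have zy : is_multiplicative_edge (z, y, y / z).
  by rewrite /= y0 z0 sS eqxx.
by exists (inr (exist (fun e => is_multiplicative_edge e) _ zy)); rewrite !inE /= eqxx orbT.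
Qed.

(** A spanning family of at most dim K vectors is a basis. The bound on the size of [S] comes from
    its k indices alone, so the conjugates need not be shown distinct. *)
Lemma normal_XE : normal_X irr_f = (fullv <= <<enum S>>)%VS.
Proof.
rewrite /normal_X basisEdim -[RHS]andbT; congr (_ && _).
rewrite -cardE (leq_trans (leq_imset_card _ _)) // card_ord.
rewrite dim_qfpoly size_scale //.
by rewrite invr_eq0 lead_coef_eq0 irredp_neq0.
Qed.

Lemma additive_connected_span :
  connected (additive_subgraph irr_f) <-> (fullv <= <<enum S>>)%VS.
Proof.
pose e := adjacent (additive_subgraph irr_f); set W := <<_>>%VS.
have SW s : s \in S -> s \in W by move=> sS; rewrite memv_span ?mem_enum.
split=> [conn | full].
  apply/subvP => z _.
  apply: (@connect_sym_invariant _ e (mem W) 0 z); last 2 first.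
  - by apply: conn; rewrite in_setT.
  - exact: mem0v.
  - exact: adjacent_sym.
  move=> a b; rewrite /e additive_adjacentE => /orP[] /SW /= ab aW.
    by rewrite -(subrK a b) memvD.
  by rewrite -[b](subKr a) memvB.
(* Quantifying over the starting point lets paths be translated and concatenated, so [reach] is
   closed under addition. *)
pose reach v := forall y : K, connect e y (y + v).
have reachD u v : reach u -> reach v -> reach (u + v).
  by move=> ru rv y; rewrite addrA; apply: connect_trans (ru y) (rv _).
have reach0 : reach 0 by move=> y; rewrite addr0.
have reachS s : s \in S -> reach s.
  by move=> sS y; rewrite connect1 // /e additive_adjacentE addrC addKr sS.
have reachZ (c : 'F_p) s : s \in S -> reach (c *: s).
  (* The scalar [c] is the image of a natural number, so [c *: s] is a repeated sum of [s]. *)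
  move=> sS; rewrite -[c]natr_Zp scaler_nat.
  elim: (c : nat) => [|n IHn]; rewrite ?mulr0n // mulrS.
  exact: reachD (reachS _ sS) IHn.
move=> y z _ _; rewrite -(subrK y z) addrC.
have /coord_span -> : z - y \in <<in_tuple (enum S)>>%VS.
  exact: subvP full _ (memvf _).
suff : reach (\sum_i coord (in_tuple (enum S)) i (z - y) *: (enum S)`_i).
  by apply.
apply: big_ind => // i _; apply: reachZ.
by rewrite -mem_enum mem_nth.
Qed.

Lemma multiplicative_connected_primitive : prime p ->
  connected (multiplicative_subgraph irr_f) <-> primitive_X irr_f.
Proof.
move=> p_pr; rewrite /primitive_X.
pose e := adjacent (multiplicative_subgraph irr_f).
set G := (<<_>>)%g.
have SG (u : {unit K}) : val u \in S -> u \in G.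
  case/imsetP=> i _ def_u.
  have ux : x \is a GRing.unit.
    (* If x were 0, the unit [u] would be a power of 0 with exponent p^i > 0, hence 0. *)
    rewrite unitfE; apply/eqP => x0.
    have := valP u; rewrite def_u x0 expr0n expn_eq0.
    by rewrite -[p == 0]negbK -lt0n prime_gt0 //= unitr0.
  have -> : u = (FinRing.unit K ux ^+ (p ^ i))%g.
    by apply: val_inj; rewrite FinRing.val_unitX.
  by rewrite groupX // mem_gen // inE.
split=> [conn | genG].
  apply/setP=> u; rewrite in_setT.
  (* Vertices are field elements while [G] consists of units, so membership in [G] is transported to
     [K]. *)
  pose inG := [pred y : K | [exists v in G, val v == y]].
  have inG_edge a b : e a b -> inG a -> inG b.
    rewrite /e multiplicative_adjacentE => /and3P[a0 b0 ab] /exists_inP[v vG].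
    move=> /eqP def_a; have ub : b \is a GRing.unit by rewrite unitfE.
    pose w := FinRing.unit K ub.
    apply/exists_inP; exists w => //.
    case/orP: ab => sS.
      have : (w * v^-1)%g \in G.
        by apply: SG; rewrite FinRing.val_unitM FinRing.val_unitV def_a.
      by rewrite groupMr ?groupV.
    have : (v * w^-1)%g \in G.
      by apply: SG; rewrite FinRing.val_unitM FinRing.val_unitV def_a.
    by rewrite groupMl ?groupV.
  have conn1u : connect e 1 (val u).
    by apply: conn; rewrite inE ?oner_eq0 // -unitfE (valP u).
  have inG1 : inG 1 by apply/exists_inP; exists 1%g.
  have /exists_inP[v vG /eqP/val_inj <- //] : inG (val u).
  exact: connect_sym_invariant (@adjacent_sym _ _) inG_edge conn1u inG1.
pose reach (v : {unit K}) := forall y : K, y != 0 -> connect e y (y * val v).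
have nz (v : {unit K}) : val v != 0 by rewrite -unitfE (valP v).
have reachG v : reach v.
  (* In a finite group, every element of a generated subgroup is a product of generators without
     inverses, so steps multiplying by x suffice. *)
  have /gen_prodgP[n [c cA ->]] : v \in G by rewrite genG inE.
  apply: big_ind => [y y0|u w ru rw y y0|i _ y y0].
  - by rewrite mulr1.
  - rewrite FinRing.val_unitM mulrA; apply: connect_trans (ru y y0) (rw _ _).
    by rewrite mulf_neq0.
  - rewrite connect1 // /e multiplicative_adjacentE y0 (mulf_neq0 y0 (nz _)) /=.
    rewrite mulrAC divff // mul1r; have := cA i; rewrite inE => /eqP ->.
    apply/orP; left; apply/imsetP.
    (* The index 0, giving x = x^(p^0), is available because an irreducible polynomial is not
       constant. *)
    have k0 : (0 < (size f).-1)%N by case: irr_f; case: (size f) => [|[]].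
    by exists (Ordinal k0); rewrite //= expr1.
move=> y z; rewrite !inE => y0 z0.
have uzy : z / y \is a GRing.unit by rewrite unitfE mulf_neq0 ?invr_eq0.
by have := reachG (FinRing.unit K uzy) y y0; rewrite /= mulrC divfK.
Qed.

End ConjugateGraph.

Theorem proposition5 (p k : nat) (hp : prime p) (hk : (1 <= k)%N)
    (f : {poly 'F_p}) (hf : irreducible_poly f) (hfk : size f = k.+1) :
  (connected (additive_subgraph hf) <-> normal_X hf) /\
  (connected (multiplicative_subgraph hf) <-> primitive_X hf).
Proof.
split; last exact: multiplicative_connected_primitive.
by rewrite normal_XE; apply: additive_connected_span.
Qed.
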